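(* Consider an $\mathrm{IFS}(T_1,\dots,T_k;\mathfrak b)$ with probabilities ($k\ge2$), where $T_1,\dots,T_k\colon X\to X$ are continuous maps of a compact metric space $X$, whose Markov operator $\mathfrak T_{\mathfrak b}$ is asymptotically stable, and let $\mu$ be its stationary measure. If $S_{\mathrm t}\ne\emptyset$, then $\mathrm{supp}(\mu)=\overline{A_{\mathrm t}}$.
   Context: $\Sigma_k^+=\{1,\dots,k\}^{\mathbb N}$. The set of weakly hyperbolic sequences is $S_{\mathrm t}=\{\xi\in\Sigma_k^+ : \lim_{n\to\infty}\mathrm{diam}(T_{\xi_0}\circ\cdots\circ T_{\xi_n}(X))=0\}$. The coding map $\pi\colon S_{\mathrm t}\to X$ is $\pi(\xi)=\lim_{n\to\infty}T_{\xi_0}\circ\cdots\circ T_{\xi_n}(p)$, which does not depend on $p\in X$. The target set is $A_{\mathrm t}=\pi(S_{\mathrm t})$. An IFS with probabilities $\mathrm{IFS}(T_1,\dots,T_k;\mathfrak b)$ consists of the maps together with the Bernoulli (product) probability $\mathfrak b=\mathfrak b(p_1,\dots,p_k)$ on $\Sigma_k^+$ with strictly positive weights $p_1,\dots,p_k$, $\sum_ip_i=1$. $\mathcal M_1(X)$ is the space of Borel probability measures on $X$ with the weak$*$ topology. The Markov operator is $\mathfrak T_{\mathfrak b}\colon\mathcal M_1(X)\to\mathcal M_1(X)$, $\mathfrak T_{\mathfrak b}\mu=\sum_{i=1}^kp_i\,T_{i*}\mu$, where $T_{i*}\mu(A)=\mu(T_i^{-1}(A))$. A stationary measure is a fixed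 point of $\mathfrak T_{\mathfrak b}$. The operator $\mathfrak T_{\mathfrak b}$ is asymptotically stable if it has a stationary measure $\nu$ with $\lim_{n\to\infty}\mathfrak T_{\mathfrak b}^n\mu=\nu$ (weak$*$) for every $\mu\in\mathcal M_1(X)$. *)

(* Defs.v *)
From HB Require Import structures.
From mathcomp Require Import all_boot all_order all_algebra.
From mathcomp Require Import all_classical all_reals all_analysis.

Set Implicit Arguments.
Unset Strict Implicit.
Unset Printing Implicit Defensive.

Import Order.TTheory GRing.Theory Num.Theory.
Import numFieldNormedType.Exports.
Local Open Scope classical_set_scope.
Local Open Scope ring_scope.

(* The distinguished point is required by [lim] and by the generated
   sigma-algebra; it only makes the space nonempty, and an empty space carries
   no probability measure. *)
#[short(type="pmetricType")]
HB.structure Definition PointedMetric (R : numDomainType) :=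
  {M of Metric R M & Pointed M}.

(* [borel X] is an alias of [X] carrying the Borel sigma-algebra. *)
Notation borel X := (g_sigma_algebraType (@open X)).

Lemma continuous_borel_measurable (R : realType) (X : pmetricType R)
    (f : X -> X) :
  continuous f -> measurable_fun [set: borel X] (f : borel X -> borel X).
Proof.
move=> /continuousP cf; apply: (@measurability _ _ (borel X) (borel X) _ _ (@open X)) => // _ [U oU <-].
by rewrite setTI; apply: sub_sigma_algebra; exact: cf.
Qed.

(* A Bernoulli measure on [nat -> 'I_k] is determined by its weights and
   determines them; the Markov operator only uses the weights. *)
Record ifs_with_probabilities (R : realType) (X : pmetricType R) (k : nat) :=
  IFSWithProbabilities {
    ifs_map : 'I_k -> X -> X ;
    ifs_weight : 'I_k -> R ;
    ifs_map_continuous : forall i, continuous (ifs_map i) ;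
    ifs_weight_gt0 : forall i, 0 < ifs_weight i ;
    ifs_weight_sum : \sum_(i < k) ifs_weight i = 1 }.

Section coding.
Context (R : realType) (X : pmetricType R) (k : nat).
Implicit Types (T : 'I_k -> X -> X) (xi : nat -> 'I_k).

Definition diam (A : set X) : \bar R :=
  ereal_sup [set (mdist x.1 x.2)%:E | x in A `*` A].

(* T_{xi 0} \o T_{xi 1} \o ... \o T_{xi n}, with n + 1 factors *)
Fixpoint ifs_comp T xi (n : nat) : X -> X :=
  if n is m.+1 then ifs_comp T xi m \o T (xi m.+1) else T (xi 0%N).

Definition weakly_hyperbolic T : set (nat -> 'I_k) :=
  [set xi | diam (ifs_comp T xi n @` [set: X]) @[n --> \oo] --> 0%E].

(* On weakly hyperbolic sequences over a compact space the limit exists and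
   does not depend on the base point, so [point] is a harmless choice. *)
Definition coding_map T xi : X := lim (ifs_comp T xi n point @[n --> \oo]).

Definition target_set T : set X := coding_map T @` weakly_hyperbolic T.

End coding.

Section markov_operator.
Context (R : realType) (X : pmetricType R) (k : nat).
Variables (I : ifs_with_probabilities X k) (mu : probability (borel X) R).

Definition markov_fun (A : set (borel X)) : \bar R :=
  (\sum_(i < k) (ifs_weight I i)%:E *
    pushforward mu (ifs_map I i : borel X -> borel X) A)%E.

Let mpre i (A : set (borel X)) :
  measurable A -> measurable ((ifs_map I i : borel X -> borel X) @^-1` A).
Proof.
move=> mA; rewrite -[X in measurable X]setTI.
apply: (continuous_borel_measurable (@ifs_map_continuous _ _ _ I i)) => //.
Qed.

Let markov0 : markov_fun set0 = 0%E.
Proof.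
rewrite /markov_fun big1// => i _.
by rewrite /pushforward preimage_set0 measure0 mule0.
Qed.

Let markov_ge0 A : (0 <= markov_fun A)%E.
Proof.
apply: sume_ge0 => i _; apply: mule_ge0; last first.
  by rewrite /pushforward; exact: measure_ge0.
by rewrite lee_fin ltW// ifs_weight_gt0.
Qed.

Let markov_sigma_additive : semi_sigma_additive markov_fun.
Proof.
move=> F mF tF mUF.
have -> : (fun n => \sum_(0 <= j < n) markov_fun (F j))%E =
    (fun n => \sum_(i < k) (ifs_weight I i)%:E *
      \sum_(0 <= j < n) mu (ifs_map I i @^-1` F j))%E.
  apply/funext => n; rewrite /markov_fun exchange_big/=; apply: eq_bigr => i _.
  by rewrite ge0_sume_distrr.
apply: cvg_nnesum.
- move=> i _; apply: nearW => n; apply: mule_ge0; last exact: sume_ge0.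
  by rewrite lee_fin ltW// ifs_weight_gt0.
- move=> i _; apply: cvgeZl => //.
  rewrite /pushforward preimage_bigcup.
  apply: measure_semi_sigma_additive.
  + by move=> n; exact: mpre.
  + apply/trivIsetP => a b _ _ ab; rewrite -preimage_setI.
    by move/trivIsetP : tF => /(_ _ _ _ _ ab) ->//; rewrite preimage_set0.
  + by rewrite -preimage_bigcup; exact: mpre.
Qed.

HB.instance Definition _ := isMeasure.Build _ _ _ markov_fun
  markov0 markov_ge0 markov_sigma_additive.

Let markov_setT : markov_fun setT = 1%E.
Proof.
rewrite /markov_fun (eq_bigr (fun i => (ifs_weight I i)%:E)) => [|i _].
  by rewrite sumEFin ifs_weight_sum.
by rewrite /pushforward preimage_setT [X in (_ * X)%E]probability_setT mule1.
Qed.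

HB.instance Definition _ :=
  Measure_isProbability.Build _ _ _ markov_fun markov_setT.

Definition markov : probability (borel X) R := markov_fun.

End markov_operator.

Section stability.
Context (R : realType) (X : pmetricType R).
Implicit Types mu nu : probability (borel X) R.

(* For compact [X] every continuous function is bounded, so these are the
   test functions of the weak* topology. *)
Definition weak_cvg (mu_ : nat -> probability (borel X) R) nu : Prop :=
  forall f : X -> R, continuous f ->
    (\int[mu_ n]_(x in [set: borel X]) f x)%R @[n --> \oo] -->
    (\int[nu]_(x in [set: borel X]) f x)%R.

(* Measures are total functions on [set (borel X)]: only their values on
   Borel sets are meaningful, hence the restriction to measurable sets. *)
Definition stationary k (I : ifs_with_probabilities X k) mu : Prop :=
  forall A : set (borel X), measurable A -> markov I mu A = mu A.

Definition asymptotically_stable k (I : ifs_with_probabilities X k) : Prop :=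
  exists2 nu, stationary I nu &
    forall mu, weak_cvg (fun n => iter n (markov I) mu) nu.

Definition supp mu : set X :=
  [set x | forall U : set X, open U -> U x -> (0 < mu U)%E].

End stability.

(* Main.v *)
Require Import Defs.
From mathcomp Require Import all_boot all_order all_algebra.
From mathcomp Require Import all_classical all_reals all_analysis.
From mathcomp Require Import measurable_realfun lra.

Import Order.TTheory GRing.Theory Num.Theory.
Import numFieldNormedType.Exports.
Local Open Scope classical_set_scope.
Local Open Scope ring_scope.

(** That the target set lies in the support is a matter of stationarity. If [c] is the coded point of a weakly
hyperbolic sequence [xi], the images of the whole space under
[T_{xi 0} \o ... \o T_{xi n}] shrink to [c] ([weakly_hyperbolicP]), so the
preimage of a neighbourhood [U] of [c] under one of these compositions is all
of [X]. Since the weights are positive, stationarity makes preimages of null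
open sets null ([stationary_ifs_comp_eq0]); hence [U] is not null. The support
being closed, it contains the closure of the target set.

Conversely, that closure [C] is closed under every [T_i]
([target_set_stable]), so the iterates of the Dirac mass at a point of the
target set (nonempty by hypothesis) all live on [C]. By stability these
iterates converge to the stationary measure [mu]
([iter_markov_Rintegral_cvg]). Testing the convergence against a tent function that is positive exactly on a ball
disjoint from [C] shows that this ball is [mu]-null ([Rintegral_bump_eq0]), so
its centre is outside the support. *)

(** * Weakly hyperbolic sequences and the target set *)

Section coding.
Context {R : realType} {X : pmetricType R} {k : nat}.
Implicit Types (T : 'I_k -> X -> X) (xi : nat -> 'I_k).

Lemma ifs_comp_range_anti T xi m n : (m <= n)%N ->
  range (ifs_comp T xi n) `<=` range (ifs_comp T xi m).
Proof.
move=> /subnK <-; elim: (n - m)%N => // j IH _ [y _ <-].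
by apply: IH; exists (T (xi (j + m).+1) y).
Qed.

Lemma diam_lt_ball (A : set X) (e : R) x y :
  (diam A < e%:E)%E -> A x -> A y -> ball x e y.
Proof.
move=> Ae Ax Ay; rewrite ballEmdist /= -lte_fin.
by apply: le_lt_trans Ae; apply: ereal_sup_ubound; exists (x, y).
Qed.

Lemma diam_le_ball (A : set X) (c : X) (e : R) :
  A `<=` ball c e -> (diam A <= (e + e)%:E)%E.
Proof.
move=> Ac; apply: ge_ereal_sup => _ [[x y] /= [Ax Ay] <-].
have := Ac _ Ax; have := Ac _ Ay; rewrite ballEmdist /= => cy cx.
rewrite lee_fin (le_trans (metric_triangle x c y))//.
by rewrite metric_sym lerD// ltW.
Qed.

Lemma diam_ge0 (A : set X) : A !=set0 -> (0 <= diam A)%E.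
Proof.
move=> [x Ax]; apply: ereal_sup_ubound; exists (x, x) => //=.
by rewrite mdistxx.
Qed.

(** Working with one statement about balls replaces both the extended-real
limit of diameters and the limit defining the coding map. Compactness serves to
produce the limit point: the images are nested, so a cluster point of one
orbit, together with the diameters tending to zero, already attracts the
images of the whole space. *)
Lemma weakly_hyperbolicP T xi c : compact [set: X] ->
  (weakly_hyperbolic T xi /\ coding_map T xi = c) <->
  (forall e : R, 0 < e ->
    \forall n \near \oo, range (ifs_comp T xi n) `<=` ball c e).
Proof.
move=> cX; split=> [[hyp <-{c}]|near_c]; last first.
  split.
    have ge0 n : (0 <= diam (range (ifs_comp T xi n)))%E.
      by apply: diam_ge0; exists (ifs_comp T xi n point), point.
    apply/fine_cvgP; split.
      near=> n; rewrite ge0_fin_numE//.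
      apply: (@le_lt_trans _ _ (1 + 1)%:E); last exact: ltry.
      apply: (@diam_le_ball _ c); near: n; exact: near_c.
    apply/cvgrPdist_le => e e0; near=> n.
    rewrite sub0r normrN /= ger0_norm ?fine_ge0//.
    apply: (@le_trans _ _ (fine (e / 2 + e / 2)%:E)).
    2: by rewrite /= -splitr.
    have le_e : (diam (range (ifs_comp T xi n)) <= (e / 2 + e / 2)%:E)%E.
      apply: (@diam_le_ball _ c); near: n; apply: near_c; exact: divr_gt0.
    apply: fine_le => //.
    by rewrite ge0_fin_numE// (le_lt_trans le_e)// ltry.
  apply: cvg_lim; first exact: metric_hausdorff.
  apply/cvg_ballP => e /near_c; apply: filterS => n; apply; by exists point.
set u := fun n => ifs_comp T xi n point.
have [c [_ cl_c]] : [set: X] `&` cluster (u @ \oo) !=set0.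
  by apply: cX; exact: filterT.
have near_c (e : R) : 0 < e ->
    \forall n \near \oo, range (ifs_comp T xi n) `<=` ball c e.
  move=> e0.
  have e20 : 0 < e / 2 by exact: divr_gt0.
  have [N _ small] : \forall n \near \oo,
      (diam (range (ifs_comp T xi n)) < (e / 2)%:E)%E.
    apply: (hyp [set y | (y < (e / 2)%:E)%E]); apply: open_nbhs_nbhs; split.
      exact: open_ereal_lt_ereal.
    by rewrite /= lte_fin.
  have : (u @ \oo) (range (ifs_comp T xi N)).
    by exists N => // m /= Nm; apply: (@ifs_comp_range_anti T xi N m).
  move=> /cl_c /(_ (nbhsx_ballx c _ e20)) [z [Nz cz]].
  exists N => // n /= Nn y fny.
  have Ny := ifs_comp_range_anti T xi _ _ Nn y fny.
  rewrite (splitr e); apply: (ball_triangle cz).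
  exact: (diam_lt_ball _ _ _ _ (small N (leqnn N)) Nz Ny).
suff -> : coding_map T xi = c by [].
apply: cvg_lim; first exact: metric_hausdorff.
apply/cvg_ballP => e /near_c; apply: filterS => n; apply; by exists point.
Unshelve. all: end_near. Qed.

Definition prepend (i : 'I_k) xi : nat -> 'I_k :=
  fun n => if n is m.+1 then xi m else i.

Lemma ifs_comp_prepend T xi i n :
  ifs_comp T (prepend i xi) n.+1 = T i \o ifs_comp T xi n.
Proof.
elim: n => [//|n IH].
by rewrite -[LHS]/(ifs_comp T (prepend i xi) n.+1 \o T (xi n.+1)) IH.
Qed.

(** Applying [T i] to the point coded by [xi] gives the point coded by [xi] with
[i] prepended; continuity of [T i] at the coded point is enough to keep the
images shrinking. *)
Lemma target_set_stable T i : compact [set: X] -> continuous (T i) ->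
  target_set T `<=` T i @^-1` target_set T.
Proof.
move=> cX Tc _ [xi hyp <-] /=.
have /(weakly_hyperbolicP _ _ _ cX) near_c :=
  conj hyp (erefl (coding_map T xi)).
suff /(weakly_hyperbolicP _ _ _ cX)[] : forall e : R, 0 < e ->
    \forall n \near \oo, range (ifs_comp T (prepend i xi) n) `<=`
      ball (T i (coding_map T xi)) e.
  by exists (prepend i xi).
move=> e e0.
have /nbhs_ballP[d /= d0 dP] := Tc (coding_map T xi) _ (nbhsx_ballx _ _ e0).
have [N _ NP] := near_c d d0; exists N.+1 => // -[//|n] Nn _ [y _ <-].
by rewrite ifs_comp_prepend; apply/dP/(NP n) => //; exists y.
Qed.

End coding.

(** * Stationary measures and iterates of the Markov operator *)

Section markov.
Context {R : realType} {X : pmetricType R} {k : nat}.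
Variable (I : ifs_with_probabilities X k).
Implicit Types mu : probability (borel X) R.

Lemma open_borel_measurable (U : set X) :
  open U -> measurable (U : set (borel X)).
Proof. exact: sub_sigma_algebra. Qed.

Lemma ifs_map_preimage_measurable i (A : set (borel X)) :
  measurable A -> measurable (ifs_map I i @^-1` A : set (borel X)).
Proof.
move=> mA; rewrite -[X in measurable X]setTI.
exact: (continuous_borel_measurable (@ifs_map_continuous _ _ _ I i)).
Qed.

(** The strict positivity of the weights enters here: all summands are
nonnegative, so a vanishing sum forces each of them, hence each mass, to
vanish. *)
Lemma markov_eq0 mu (A : set (borel X)) :
  Defs.markov I mu A = 0%E <-> forall i, mu (ifs_map I i @^-1` A) = 0%E.
Proof.
have w_gt0 i : (0 < (ifs_weight I i)%:E)%E by rewrite lte_fin ifs_weight_gt0.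
rewrite /Defs.markov /= /markov_fun /pushforward; split=> [S0 i|z]; last first.
  by rewrite big1// => i _; rewrite z mule0.
apply/eqP; have : ((ifs_weight I i)%:E * mu (ifs_map I i @^-1` A) == 0)%E.
  move/eqP: S0; rewrite seq_psume_eq0.
    by move/allP => /(_ i); apply; rewrite mem_index_enum.
  by move=> j _; apply: mule_ge0; [exact: ltW|exact: measure_ge0].
by rewrite mule_eq0 gt_eqF.
Qed.

(** Induction on the length of the composition, one factor at a time; the
preimages stay open, hence measurable, by continuity. *)
Lemma stationary_ifs_comp_eq0 mu xi (U : set X) n : stationary I mu -> open U ->
  mu U = 0%E -> mu (ifs_comp (ifs_map I) xi n @^-1` U) = 0%E.
Proof.
move=> smu oU U0.
have step i (V : set X) : open V -> mu V = 0%E ->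
    mu (ifs_map I i @^-1` V) = 0%E.
  move=> oV V0; apply: (markov_eq0 mu V).1 i.
  by rewrite smu//; exact: open_borel_measurable.
suff [] : open (ifs_comp (ifs_map I) xi n @^-1` U) /\
    mu (ifs_comp (ifs_map I) xi n @^-1` U) = 0%E by [].
elim: n => [|n [oV V0]] /=.
  split; last exact: step.
  by move/continuousP: (@ifs_map_continuous _ _ _ I (xi 0%N)); apply.
split; last by rewrite comp_preimage; exact: step.
rewrite comp_preimage.
by move/continuousP: (@ifs_map_continuous _ _ _ I (xi n.+1)); apply.
Qed.

Lemma target_set_sub_supp mu : compact [set: X] -> stationary I mu ->
  target_set (ifs_map I) `<=` supp mu.
Proof.
move=> cX smu _ [xi hyp <-] U oU Ux.
have /(weakly_hyperbolicP _ _ _ cX) near_c :=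
  conj hyp (erefl (coding_map (ifs_map I) xi)).
have /nbhs_ballP[e /= e0 eU] := open_nbhs_nbhs (conj oU Ux).
rewrite lt0e measure_ge0 andbT; apply/eqP => U0.
have [n _ /(_ n (leqnn n)) sub] := near_c e e0.
have := stationary_ifs_comp_eq0 mu xi U n smu oU U0.
have -> : ifs_comp (ifs_map I) xi n @^-1` U = [set: X].
  by apply/seteqP; split=> // y _ /=; apply: eU; apply: sub; exists y.
by rewrite [mu _]probability_setT => /eqP; rewrite onee_eq0.
Qed.

Lemma closed_supp mu : closed (supp mu).
Proof.
move=> x clx U oU Ux.
by have [y [ys /(ys _ oU)]] := clx U (open_nbhs_nbhs (conj oU Ux)).
Qed.

(** Each map sends [C] into itself, so the preimages of its complement, whose
masses the operator averages, lie in that complement. *)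
Lemma iter_markov_eq0 mu (C : set X) : closed C ->
  (forall i, C `<=` ifs_map I i @^-1` C) -> mu (~` C) = 0%E ->
  forall n, iter n (Defs.markov I) mu (~` C) = 0%E.
Proof.
move=> cC stC C0; elim=> //= n IH; apply/markov_eq0 => i.
have mC : measurable (~` C : set (borel X)).
  by apply: open_borel_measurable; exact: closed_openC.
apply: (subset_measure0 _ mC _ IH); first exact: ifs_map_preimage_measurable.
by move=> y /= nCy /(stC i).
Qed.

Lemma iter_markov_stationary mu n (A : set (borel X)) : stationary I mu ->
  measurable A -> iter n (Defs.markov I) mu A = mu A.
Proof.
move=> smu; elim: n A => // n IH A mA; rewrite -[RHS]smu//=.
rewrite /markov_fun; apply: eq_bigr => i _; rewrite /pushforward IH//.
exact: ifs_map_preimage_measurable.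
Qed.

(** The limit given by asymptotic stability may be replaced by any stationary
measure [mu]: starting the iteration at [mu] itself gives a constant sequence of
integrals, so [mu] and the limit have the same integral against [f]. *)
Lemma iter_markov_Rintegral_cvg mu (f : X -> R) : asymptotically_stable I ->
  stationary I mu -> continuous f -> forall mu',
  (\int[iter n (Defs.markov I) mu']_(x in [set: borel X]) f x)%R
    @[n --> \oo] -->
  (\int[mu]_(x in [set: borel X]) f x)%R.
Proof.
move=> [nu _ stable] smu cf mu'.
suff -> : (\int[mu]_(x in [set: borel X]) f x)%R =
    (\int[nu]_(x in [set: borel X]) f x)%R by exact: stable.
have /cvg_lim <- // := stable mu f cf.
apply/esym/cvg_lim => //.
rewrite [X in X @ _ --> _](_ : _ =
  fun=> (\int[mu]_(x in [set: borel X]) f x)%R).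
  exact: cvg_cst.
apply/funext => n; rewrite /Rintegral; congr fine.
apply: eq_measure_integral => A mA _; exact: iter_markov_stationary.
Qed.

End markov.

(** * Tent functions detect null balls *)

Section bump.
Context {R : realType} {X : pmetricType R}.

Lemma open_metric_ball (c : X) (e : R) : open (ball c e).
Proof.
rewrite openE => x; rewrite ballEmdist /= => cx; apply/nbhs_ballP.
exists (e - mdist c x); first by rewrite /= subr_gt0.
move=> y; rewrite !ballEmdist /= ltrBrDl.
exact/le_lt_trans/metric_triangle.
Qed.

Definition bump (c : X) (e : R) (x : X) : R := Num.max 0 (e - mdist c x).

Lemma bump_ge0 c e x : 0 <= bump c e x.
Proof. by rewrite /bump le_max lexx. Qed.

Lemma bump_le c e x : 0 < e -> bump c e x <= e.
Proof. by move=> e0; rewrite /bump ge_max (ltW e0) gerBl mdist_ge0. Qed.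

Lemma bump_neq0 c e x : (bump c e x != 0) = (mdist c x < e).
Proof.
rewrite -subr_gt0 /bump; case: ltP => [/gt_eqF->//|le0].
by rewrite eqxx.
Qed.

Lemma continuous_bump c e : continuous (bump c e).
Proof.
move=> x; apply/(@cvgrPdist_lt _ R^o) => d d0.
apply/nbhs_ballP; exists d => //= y; rewrite ballEmdist /= => xy.
apply: le_lt_trans xy; rewrite /bump.
have := metric_triangle c x y; have := metric_triangle c y x.
rewrite (metric_sym y x).
move: (mdist c x) (mdist c y) (mdist x y) => a b t ab ba.
rewrite ler_norml; case: (leP 0 (e - a)); case: (leP 0 (e - b)) => ? ?;
  by apply/andP; split; lra.
Qed.

Lemma continuous_borel_measurable_real (f : X -> R) :
  continuous f -> measurable_fun [set: borel X] (f : borel X -> R).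
Proof.
move=> /continuousP cf; apply: (measurability _ (RGenOpens.measurableE R)).
move=> _ [_ [a [b ->] <-]]; rewrite setTI.
by apply: sub_sigma_algebra; apply: cf; exact: interval_open.
Qed.

(** The tent function is nonnegative and nonzero exactly on the ball, so its
extended-real integral vanishes iff the ball is null. It is bounded, so that
integral is finite; this matters because the real-valued integral is also [0]
when the extended-real one is infinite. *)
Lemma Rintegral_bump_eq0 (mu : probability (borel X) R) (c : X) (e : R) :
  0 < e ->
  (\int[mu]_(x in [set: borel X]) bump c e x)%R = 0 <-> mu (ball c e) = 0%E.
Proof.
move=> e0.
have mb : measurable_fun [set: borel X] (fun x : borel X => (bump c e x)%:E).
  apply/measurable_EFinP.
  exact: continuous_borel_measurable_real (continuous_bump c e).
have b0 (x : borel X) : [set: borel X] x -> (0 <= (bump c e x)%:E)%E.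
  by rewrite lee_fin bump_ge0.
have fin : (\int[mu]_(x in [set: borel X]) (bump c e x)%:E)%E \is a fin_num.
  rewrite ge0_fin_numE ?integral_ge0//.
  apply: (@le_lt_trans _ _ (\int[mu]_(x in [set: borel X]) e%:E)%E).
    by apply: ge0_le_integral => // x _; rewrite lee_fin bump_le.
  by rewrite integral_cst// [X in (_ * X)%E]probability_setT mule1 ltry.
have zero_abs : (\int[mu]_(x in [set: borel X]) bump c e x)%R = 0 <->
    (\int[mu]_(x in [set: borel X]) `|(bump c e x)%:E|)%E = 0%E.
  rewrite (@eq_integral _ _ _ mu _ (fun x : borel X => (bump c e x)%:E)).
  2: by move=> x _; rewrite gee0_abs// b0.
  rewrite /Rintegral; split=> [|->//]; move/eqP.
  by rewrite fine_eq0// => /eqP.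
rewrite zero_abs ae_eq_integral_abs//.
have mball : measurable (ball c e : set (borel X)).
  apply: sub_sigma_algebra; exact: open_metric_ball.
rewrite -(negligibleP mu mball) /ae_eq /almost_everywhere.
suff <- : ~` [set x : borel X | [set: borel X] x -> (bump c e x)%:E = 0%E] =
  ball c e by [].
apply/seteqP; split=> x /=; rewrite ballEmdist /= -bump_neq0.
  by move=> nz; apply/eqP => bx; apply: nz => _; rewrite bx.
by move=> /eqP nz /(_ I) [].
Qed.

End bump.

(** * The support of the stationary measure *)

Theorem proposition5p4 (R : realType) (X : pmetricType R) (k : nat)
    (I : ifs_with_probabilities X k) (mu : probability (borel X) R) :
  (2 <= k)%N ->
  compact [set: X] ->
  asymptotically_stable I ->
  stationary I mu ->
  weakly_hyperbolic (ifs_map I) !=set0 ->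
  supp mu = closure (target_set (ifs_map I)).
Proof.
move=> _ cX stable smu [xi hyp]; apply/seteqP; split; last first.
  rewrite closureEbigcap => x; apply; split; [exact: closed_supp|].
  exact: target_set_sub_supp.
set C := closure _; move=> x sx; apply: contrapT => nCx.
have cC : closed C by exact: closed_closure.
have /nbhs_ballP[e /= e0 eC] := open_nbhs_nbhs (conj (closed_openC cC) nCx).
have stC i : C `<=` ifs_map I i @^-1` C.
  have cT := @ifs_map_continuous _ _ _ I i.
  have /closure_id -> : closed (ifs_map I i @^-1` C).
    by apply: preimage_closed => // y _; exact: cT.
  apply: closureS => y /(target_set_stable _ i cX cT) ty.
  exact: (@subset_closure _ _ (ifs_map I i y) ty).
pose p : borel X := coding_map (ifs_map I) xi.
have Cp : C p by apply: subset_closure; exists xi.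
have p0 : \d_p (~` C : set (borel X)) = 0%E :> \bar R.
  by rewrite diracE memNset//= => /(_ Cp).
have ball0 n :
    iter n (Defs.markov I) (\d_p : probability (borel X) R) (ball x e) = 0%E.
  have mC : measurable (~` C : set (borel X)).
    by apply: open_borel_measurable; exact: closed_openC.
  apply: (subset_measure0 _ mC eC); last exact: iter_markov_eq0.
  by apply: open_borel_measurable; exact: open_metric_ball.
suff : mu (ball x e) = 0%E.
  move=> mu0; have := sx _ (open_metric_ball x e) (ballxx _ e0).
  by rewrite mu0 ltxx.
apply/(Rintegral_bump_eq0 mu x e e0).
have /cvg_lim <-// := iter_markov_Rintegral_cvg I mu _ stable smu
  (continuous_bump x e) \d_p.
apply: cvg_lim => //.
rewrite [X in X @ _ --> _](_ : _ = fun=> 0); first exact: cvg_cst.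
apply/funext => n; exact/Rintegral_bump_eq0.
Qed.
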